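(* Suppose that a subsample of size $k$ is taken from the $n$ data points $(\mathbf{z}_i,y_i)$ using a random subsampling procedure with probabilities proportional to $\pi_i$, $i=1,\dots,n$, such that $\sum_{i=1}^n\pi_i=1$. Let $\boldsymbol{\eta}_L=(\eta_{L1},\dots,\eta_{Ln})$ be the $n$-dimensional vector that counts how often each data point is included in the subsample. Consider the set $\Delta=\{\boldsymbol{\eta}_L:\sum_{i=1}^n\eta_{Li}\mathbf{x}_i\mathbf{x}_i^{\rm T}\text{ is non-singular}\}$, and let $I_\Delta(\boldsymbol{\eta}_L)=1$ if and only if $\boldsymbol{\eta}_L\in\Delta$. Let $$\tilde{\boldsymbol\beta}_L=\Big(\sum_{i=1}^n w_i\eta_{Li}\mathbf{x}_i\mathbf{x}_i^{\rm T}\Big)^{-1}\sum_{i=1}^n w_i\eta_{Li}\mathbf{x}_iy_i$$ be the subsampling-based estimator with weights $w_i$. Then, given $I_\Delta(\boldsymbol{\eta}_L)=1$, $\tilde{\boldsymbol\beta}_L$ is unbiased for $\boldsymbol\beta$, and $$\mathrm{V}\{\tilde{\boldsymbol\beta}_L|\mathbf{Z},I_\Delta(\boldsymbol{\eta}_L)=1\}\ \ge\ P\{I_\Delta(\boldsymbol{\eta}_L)=1|\mathbf{Z}\}\,\mathbf{M}_{EL}^{-1}=\frac{\sigma^2P\{I_\Delta(\boldsymbol{\eta}_L)=1|\mathbf{Z}\}}{k}\Big\{\sum_{i=1}^n\pi_i\mathbf{x}_i\mathbf{x}_i^{\rm T}\Big\}^{-1}$$ in the Loewner ordering, where $\mathbf{M}_{EL}=\frac{k}{\sigma^2}\sum_{i=1}^n\pi_i\mathbf{x}_i\mathbf{x}_i^{\rm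 T}$. This is true regardless of the choice of the weights $w_i$ and of whether the subsampling is with or without replacement.
   Context: Model: $y_i=\beta_0+\mathbf{z}_i^{\rm T}\boldsymbol\beta_1+\varepsilon_i$, $i=1,\dots,n$, where $\mathbf{z}_i\in\mathbb{R}^p$ is a covariate vector, $\mathbf{x}_i=(1,\mathbf{z}_i^{\rm T})^{\rm T}$, $\boldsymbol\beta=(\beta_0,\boldsymbol\beta_1^{\rm T})^{\rm T}$ is the unknown parameter and $\mathbf{Z}=(\mathbf{z}_1,\dots,\mathbf{z}_n)^{\rm T}$. The $y_i$ are uncorrelated given $\mathbf{Z}$, and the error terms satisfy $\mathrm{E}(\varepsilon_i)=0$ and $\mathrm{V}(\varepsilon_i)=\sigma^2$. Subsampling: if it is with replacement, each $\eta_{Li}$ has marginally a Binomial$(k,\pi_i)$ distribution; if it is without replacement, the marginal distribution of each $\eta_{Li}$ is Binomial$(1,k\pi_i)$, under the condition $k\pi_i\le1$. The $\eta_{Li}$ may be correlated. In either case $\mathrm{E}(\eta_{Li})=k\pi_i$, so $\mathbf{M}_{EL}$ is the expectation given $\mathbf{Z}$ (over $\boldsymbol{\eta}_L$) of $\frac{1}{\sigma^2}\sum_{i=1}^n\eta_{Li}\mathbf{x}_i\mathbf{x}_i^{\rm T}$. The weight $w_i$ is often taken to be $1/\pi_i$; another common choice is $w_i=1$. $\mathrm{V}$ denotes the variance or covariance matrix. For symmetric matrices, $A\ge B$ in the Loewner ordering means that $A-B$ is positive semidefinite.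
   Formalization: The weights w_i are assumed positive whenever π_i>0 (otherwise the inverse in the estimator may not exist on Δ), the counts are assumed independent of the responses given Z, and σ>0 and P(I_Δ=1|Z)>0 are assumed. *)

(* Defs.v *)
From HB Require Import structures.
From mathcomp Require Import all_boot all_order all_algebra.
From mathcomp Require Import all_classical all_reals all_analysis.

Set Implicit Arguments.
Unset Strict Implicit.
Unset Printing Implicit Defensive.

Import Order.TTheory GRing.Theory Num.Theory.
Import numFieldNormedType.Exports.

Local Open Scope classical_set_scope.
Local Open Scope ring_scope.

(* The covariates Z are a fixed matrix whose i-th row is z_i, and the
   probability P below is the (conditional) law given Z: every "given Z" is
   expressed by quantifying over Z and P. *)

Section design.
Context {R : realType} {n p : nat}.
Implicit Types (Z : 'M[R]_(n, p)) (c : 'I_n -> R) (m : 'I_n -> nat).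

Definition regressor Z (i : 'I_n) : 'cV[R]_(1 + p) :=
  col_mx 1%:M (row i Z)^T.

Definition gram Z c : 'M[R]_(1 + p) :=
  \sum_(i < n) c i *: (regressor Z i *m (regressor Z i)^T).

Definition Delta Z : set ('I_n -> nat) :=
  [set m | gram Z (fun i => (m i)%:R) \in unitmx].

(* [invmx] is the identity on singular matrices, so this is meaningful only
   when [gram Z (fun i => w i * (m i)%:R)] is invertible; for weights that are
   positive wherever m is, this is the case exactly for m in [Delta Z]. *)
Definition subsample_estimator Z (w y : 'I_n -> R) m : 'cV[R]_(1 + p) :=
  invmx (gram Z (fun i => w i * (m i)%:R)) *m
    \sum_(i < n) (w i * (m i)%:R * y i) *: regressor Z i.

End design.

Definition psd {R : realType} {m : nat} (A : 'M[R]_m) : Prop :=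
  A^T = A /\ forall u : 'cV[R]_m, 0 <= (u^T *m A *m u) 0 0.

Definition loewner_ge {R : realType} {m : nat} (A B : 'M[R]_m) : Prop :=
  psd (A - B).

Section probability.
Context {d : measure_display} {T : measurableType d} {R : realType}.
Implicit Types (P : probability T R).

(* B |-> P (B `&` A) / P A. When P A = 0, [mnormalize] returns its default
   argument, here P. *)
Definition cond_prob P (A : set T) (mA : measurable A) : probability T R :=
  mnormalize (mrestr P mA) P.

(* Entrywise [fine] sends infinite covariances to 0, so finiteness must be
   claimed separately. *)
Definition cov_mx P {m : nat} (X : T -> 'cV[R]_m) : 'M[R]_m :=
  \matrix_(a, b) fine (covariance P (fun t => X t a 0) (fun t => X t b 0)).

Definition expectation_mx P {m q : nat} (X : T -> 'M[R]_(m, q)) : 'M[R]_(m, q) :=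
  \matrix_(a, b) fine 'E_P[fun t => X t a b].

(* Independence of two random vectors: the sigma-algebras generated by all the
   components of each are independent. *)
Definition independent_families P d1 d2 (T1 : measurableType d1)
    (T2 : measurableType d2) (m q : nat)
    (X : 'I_m -> T -> T1) (Y : 'I_q -> T -> T2) : Prop :=
  forall A B, g_sigma_preimage X A -> g_sigma_preimage Y B ->
    P (A `&` B) = (P A * P B)%E.

(* Only the marginals are constrained: the counts may be correlated. *)
Definition with_replacement P {n : nat} (k : nat) (pi_ : 'I_n -> R)
    (eta : 'I_n -> {RV P >-> nat}) : Prop :=
  forall i, distribution P (eta i) =1 binomial_prob k (pi_ i).

Definition without_replacement P {n : nat} (k : nat) (pi_ : 'I_n -> R)
    (eta : 'I_n -> {RV P >-> nat}) : Prop :=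
  (forall i, k%:R * pi_ i <= 1) /\
  (forall i, distribution P (eta i) =1 binomial_prob 1 (k%:R * pi_ i)).

Definition random_subsample P {n : nat} (k : nat) (pi_ : 'I_n -> R)
    (eta : 'I_n -> {RV P >-> nat}) : Prop :=
  [/\ forall i, 0 <= pi_ i,
      \sum_(i < n) pi_ i = 1,
      {ae P, forall t, (\sum_(i < n) eta i t)%N = k} &
      with_replacement k pi_ eta \/ without_replacement k pi_ eta].

End probability.

Section model.
Context {d : measure_display} {T : measurableType d} {R : realType}
  (P : probability T R) {n p : nat}.
Implicit Types (Z : 'M[R]_(n, p)) (eta : 'I_n -> {RV P >-> nat})
  (eps : 'I_n -> {RV P >-> R}).

Definition response Z (beta0 : R) (beta1 : 'cV[R]_p) eps (i : 'I_n) (t : T) : R :=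
  beta0 + (row i Z *m beta1) 0 0 + eps i t.

Definition Delta_event Z eta : set T :=
  [set t | Delta Z (fun i => eta i t)].

Lemma measurable_Delta_event Z eta : measurable (Delta_event Z eta).
Proof.
pose F (m : {ffun 'I_n -> nat}) : set T :=
  if `[< Delta Z m >] then \big[setI/setT]_(i < n) (eta i @^-1` [set m i]) else set0.
have -> : Delta_event Z eta = \bigcup_m F m.
  apply/seteqP; split => [t Dt|t [m _]].
    exists [ffun i => eta i t] => //; rewrite /F.
    have -> : ([ffun i => eta i t] : 'I_n -> nat) = (fun i => eta i t).
      by apply/funext => i; rewrite ffunE.
    rewrite asboolT // -bigcap_seq => i _ /=.
    by [].
  rewrite /F; case: asboolP => // Dm; rewrite -bigcap_seq => H.
  rewrite /Delta_event /=; suff -> : (fun i => eta i t) = m by [].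
  by apply/funext => i; apply: H; rewrite /= mem_index_enum.
apply: countable_bigcupT_measurable => [|m]; first exact: countableP.
rewrite /F; case: ifP => // _.
apply: bigsetI_measurable => i _; rewrite -[X in measurable X]setTI.
exact: (measurable_funPT (eta i)).
Qed.

(* M_EL: the expectation over the subsampling of the information matrix
   sigma^-2 \sum_i eta_i x_i x_i^T. *)
Definition expected_information Z (sigma : R) eta : 'M[R]_(1 + p) :=
  expectation_mx P (fun t => (sigma ^+ 2)^-1 *: gram Z (fun i => (eta i t)%:R)).

End model.

(* Main.v *)
Require Import Defs.
From HB Require Import structures.
From mathcomp Require Import all_boot all_order all_algebra.
From mathcomp Require Import all_classical all_reals all_analysis.
From mathcomp Require Import measurable_realfun.
From mathcomp Require Import ring lra.

Set Implicit Arguments.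
Unset Strict Implicit.
Unset Printing Implicit Defensive.

Import Order.TTheory GRing.Theory Num.Theory.
Import numFieldNormedType.Exports.

Local Open Scope classical_set_scope.
Local Open Scope ring_scope.

(**
  Given counts m in Delta, the estimator is the linear map C(m) y, where the
  columns c_i of C(m) satisfy sum_i c_i x_i^T = 1 and c_i = 0 whenever m_i = 0.
  The counts take finitely many values almost surely and are independent of the
  errors, so conditioning on Delta and on the value m gives mean beta and, with
  q_m = P(m | Delta), covariance sigma^2 sum_m q_m C(m) C(m)^T.  For row vectors
  u, v indexed by the parameters and a scalar l,
    |u C(m)|^2 >= 2 l u.v - l^2 sum_i m_i (v.x_i)^2,
  since m_i >= 1 where c_i <> 0.  Averaging over m, with q_m <= P(m) / P(Delta)
  and E(eta_i) = k pi_i, replaces the last sum by k / P(Delta) times the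
  quadratic form of sum_i pi_i x_i x_i^T, and optimizing v and l gives the bound.
*)

(** * Gram matrices and the estimator at fixed counts *)

Lemma mulmx_col_row (R : pzSemiRingType) m q (A : 'M[R]_(m, 1)) (B : 'M[R]_(1, q)) a b :
  (A *m B) a b = A a 0 * B 0 b.
Proof. by rewrite mxE big_ord1. Qed.

Section gram_matrices.
Context {R : realType} {n p : nat} (Z : 'M[R]_(n, p)).
Implicit Types (c w : 'I_n -> R) (m : 'I_n -> nat) (u v : 'cV[R]_(1 + p)).

Local Notation x := (regressor Z).

Lemma tr_gram c : (gram Z c)^T = gram Z c.
Proof.
rewrite /gram linear_sum; apply: eq_bigr => i _.
by rewrite linearZ /= trmx_mul trmxK.
Qed.

Lemma gram_form c u v :
  (u^T *m gram Z c *m v) 0 0 =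
  \sum_i c i * ((u^T *m x i) 0 0 * (v^T *m x i) 0 0).
Proof.
rewrite /gram mulmx_sumr mulmx_suml summxE; apply: eq_bigr => i _.
rewrite -scalemxAr -scalemxAl mxE; congr (_ * _).
rewrite !mulmxA -(mulmxA (u^T *m x i)) mulmx_col_row; congr (_ * _).
by rewrite -[(x i)^T *m v]trmxK trmx_mul trmxK mxE.
Qed.

Lemma gramZ a c : gram Z (fun i => a * c i) = a *: gram Z c.
Proof.
rewrite /gram scaler_sumr; apply: eq_bigr => i _.
by rewrite scalerA.
Qed.

Lemma gram_sum (S : finType) (a : S -> R) (c : S -> 'I_n -> R) :
  gram Z (fun i => \sum_s a s * c s i) = \sum_s a s *: gram Z (c s).
Proof.
rewrite /gram; under [RHS]eq_bigr do rewrite scaler_sumr.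
rewrite exchange_big /=; apply: eq_bigr => i _.
by rewrite scaler_suml; apply: eq_bigr => s _; rewrite scalerA.
Qed.

(** If v annihilates the Gram matrix of c, its quadratic form at v is a vanishing sum of nonnegative
    terms, so v is orthogonal to every regressor in the support of c, hence in that of c', and the
    Gram matrix of c' forces v = 0. *)
Lemma gram_support_unit c c' :
    (forall i, 0 <= c i) -> (forall i, c' i != 0 -> c i != 0) ->
  gram Z c' \in unitmx -> gram Z c \in unitmx.
Proof.
move=> c0 cc' uc'; rewrite -row_free_unit; apply: inj_row_free => v vc.
pose u := v^T; have : (u^T *m gram Z c *m u) 0 0 = 0.
  by rewrite trmxK vc mul0mx mxE.
rewrite gram_form => /eqP; rewrite psumr_eq0 => [/allP ux|i _]; last first.
  by rewrite mulr_ge0// -expr2 sqr_ge0.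
suff : v *m gram Z c' = 0 by move/(canRL (mulmxK uc')); rewrite mul0mx.
rewrite mulmx_sumr big1// => i _; rewrite -scalemxAr.
have [->|c'i] := eqVneq (c' i) 0; first by rewrite scale0r.
have := ux i (mem_index_enum _); rewrite implyTb.
rewrite mulf_eq0 (negbTE (cc' _ c'i)) /= -expr2 sqrf_eq0 trmxK => /eqP vx.
by rewrite mulmxA [v *m x i]mx11_scalar vx raddf0 mul0mx scaler0.
Qed.

(** The matrix C(m) that maps the responses to the estimate. *)
Definition estimator_mx w m : 'M[R]_(1 + p, n) :=
  \matrix_(a, i) (invmx (gram Z (fun j => w j * (m j)%:R)) *m
    ((w i * (m i)%:R) *: x i)) a 0.

Lemma subsample_estimatorE w (y : 'I_n -> R) m a :
  subsample_estimator Z w y m a 0 = \sum_i estimator_mx w m a i * y i.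
Proof.
rewrite /subsample_estimator mulmx_sumr summxE; apply: eq_bigr => i _.
by rewrite [in RHS]mxE -!scalemxAr !mxE mulrAC.
Qed.

Lemma estimator_mx0 w m a i : m i = 0%N -> estimator_mx w m a i = 0.
Proof. by move=> mi; rewrite mxE mi mulr0 scale0r mulmx0 mxE. Qed.

Variables (w : 'I_n -> R) (m : 'I_n -> nat).
Hypothesis w_gt0 : forall i, (0 < m i)%N -> 0 < w i.
Hypothesis Dm : Delta Z m.

Lemma weighted_gram_unit : gram Z (fun i => w i * (m i)%:R) \in unitmx.
Proof.
apply: gram_support_unit Dm => i.
  have [->|mi] := posnP (m i); first by rewrite mulr0.
  by rewrite mulr_ge0// ltW// w_gt0.
rewrite pnatr_eq0 -lt0n => mi.
by rewrite mulf_neq0 ?gt_eqF ?w_gt0 ?ltr0n.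
Qed.

(** The weights occur both in C(m) and in the inverted matrix, so the sum is that inverse times the
    weighted Gram matrix. *)
Lemma estimator_mx_regressor : \sum_i col i (estimator_mx w m) *m (x i)^T = 1%:M.
Proof.
rewrite -(mulVmx weighted_gram_unit) /gram mulmx_sumr; apply: eq_bigr => i _.
rewrite scalemxAl mulmxA; congr (_ *m _).
by apply/colP => a; rewrite !mxE.
Qed.

(** Unbiasedness at fixed counts: noiseless linear responses return their own parameter. *)
Lemma estimator_mx_fit (b : 'cV[R]_(1 + p)) a :
  \sum_i estimator_mx w m a i * ((x i)^T *m b) 0 0 = b a 0.
Proof.
rewrite -[in RHS](mul1mx b) -estimator_mx_regressor mulmx_suml summxE.
apply: eq_bigr => i _.
by rewrite -mulmxA mulmx_col_row [col _ _ _ _]mxE.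
Qed.

(* Completing the square: u C and v X are row vectors indexed by the data
   points, and only points with m i > 0 contribute to u C. *)
Lemma estimator_mx_sqr_ge u v (l : R) :
  2 * l * (u^T *m v) 0 0 - l ^+ 2 * (v^T *m gram Z (fun i => (m i)%:R) *m v) 0 0
  <= \sum_i ((u^T *m estimator_mx w m) 0 i) ^+ 2.
Proof.
have -> : (u^T *m v) 0 0 =
    \sum_i (u^T *m estimator_mx w m) 0 i * (v^T *m x i) 0 0.
  rewrite -[in LHS](mul1mx v) -estimator_mx_regressor mulmx_suml mulmx_sumr summxE.
  apply: eq_bigr => i _; rewrite !mulmxA -(mulmxA (u^T *m _)) mulmx_col_row.
  rewrite -[(x i)^T *m v]trmxK trmx_mul trmxK; congr (_ * _); last by rewrite mxE.
  by rewrite !mxE; apply: eq_bigr => a _; rewrite [col _ _ _ _]mxE.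
rewrite gram_form !mulr_sumr -sumrB ler_sum// => i _.
set e := (u^T *m _) 0 i; set f := (v^T *m _) 0 0.
have [mi|mi] := posnP (m i).
  have -> : e = 0.
    by rewrite /e mxE big1// => a _; rewrite (estimator_mx0 _ _ mi) mulr0.
  by rewrite mi !(mul0r, mulr0) subr0 expr0n.
rewrite -subr_ge0.
have -> : e ^+ 2 - (2 * l * (e * f) - l ^+ 2 * ((m i)%:R * (f * f))) =
  (e - l * f) ^+ 2 + ((m i)%:R - 1) * (l * f) ^+ 2 by ring.
by rewrite addr_ge0 ?sqr_ge0// mulr_ge0 ?sqr_ge0// subr_ge0 ler1n.
Qed.

End gram_matrices.

(** * The quadratic-form bound averaged over random counts *)

Section mixture_bound.
Context {R : realType} {n p : nat} (Z : 'M[R]_(n, p)) (S : finType).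
(** In the application [q] is the law of the counts given Delta, [r] their unconditional law and [D]
    the probability of Delta. *)
Context (q r : S -> R) (m : S -> 'I_n -> nat) (w pi_ : 'I_n -> R) (D k : R).
Hypothesis D_gt0 : 0 < D.
Hypothesis k_gt0 : 0 < k.
Hypothesis q_ge0 : forall s, 0 <= q s.
Hypothesis q_sum : \sum_s q s = 1.
Hypothesis q_le : forall s, q s <= r s / D.
Hypothesis q_Delta : forall s, q s != 0 -> Delta Z (m s).
Hypothesis q_weight : forall s i, q s != 0 -> (0 < m s i)%N -> 0 < w i.
Hypothesis r_mean : forall i, \sum_s r s * (m s i)%:R = k * pi_ i.
Hypothesis pi_unit : gram Z pi_ \in unitmx.

(* The bound 2 l u.v - l^2 v^T G v is optimal for the averaged Gram matrix
   (k / D) G_pi at v = G_pi^-1 u and l = D / k. *)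
Lemma mixture_estimator_bound (u : 'cV[R]_(1 + p)) :
  D / k * (u^T *m invmx (gram Z pi_) *m u) 0 0 <=
  \sum_s q s * \sum_i ((u^T *m estimator_mx Z w (m s)) 0 i) ^+ 2.
Proof.
pose v := invmx (gram Z pi_) *m u; pose l := D / k.
pose B := (u^T *m v) 0 0; pose g s := (v^T *m gram Z (fun i => (m s i)%:R) *m v) 0 0.
have BE : (v^T *m gram Z pi_ *m v) 0 0 = B.
  rewrite /v mulmxA mulmxK//= trmx_mul trmx_inv tr_gram /B /v.
  by rewrite mulmxA.
have g_ge0 s : 0 <= g s.
  rewrite /g gram_form sumr_ge0// => i _.
  by rewrite mulr_ge0// -expr2 sqr_ge0.
have r_g : \sum_s r s * g s = k * B.
  rewrite -BE gram_form mulr_sumr; under eq_bigr do rewrite /g gram_form mulr_sumr.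
  rewrite exchange_big /=; apply: eq_bigr => i _.
  by rewrite mulrA -r_mean mulr_suml; apply: eq_bigr => s _; rewrite mulrA.
(* Since [g] is nonnegative, [q_le] replaces the conditional mean, which is unknown, by the
   unconditional one, which is k B. *)
have q_g : \sum_s q s * g s <= k / D * B.
  rewrite mulrAC -r_g mulr_suml ler_sum// => s _.
  by rewrite mulrAC ler_wpM2r.
apply: (@le_trans _ _ (\sum_s q s * (2 * l * B - l ^+ 2 * g s))); last first.
  apply: ler_sum => s _; have [->|qs] := eqVneq (q s) 0; first by rewrite !mul0r.
  rewrite ler_wpM2l//; apply: estimator_mx_sqr_ge; last exact: q_Delta.
  by move=> i; exact: q_weight.
have -> : \sum_s q s * (2 * l * B - l ^+ 2 * g s) =
    2 * l * B - l ^+ 2 * \sum_s q s * g s.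
  under eq_bigr do rewrite mulrBr (mulrCA _ (l ^+ 2)).
  by rewrite sumrB -mulr_suml q_sum mul1r mulr_sumr.
rewrite -mulmxA -/v -/B -/l.
(* With this choice of [l] the quadratic term is at most l B, leaving 2 l B - l B = l B. *)
have lk : l * (k / D) = 1 by rewrite /l mulrA divfK ?divff ?gt_eqF.
have : l ^+ 2 * \sum_s q s * g s <= l ^+ 2 * (k / D * B) by rewrite ler_wpM2l ?sqr_ge0.
have -> : l ^+ 2 * (k / D * B) = l * B by rewrite expr2 mulrACA lk mul1r.
lra.
Qed.

End mixture_bound.

(** * Integrals over an event independent of the integrand *)

Section restricted_independence.
Context {d : measure_display} {T : measurableType d} {R : realType}.
Context (Q P : probability T R) (A : set T) (f : T -> R).
Hypothesis mA : measurable A.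
Hypothesis intf : P.-integrable setT (EFin \o f).
(** Two measures occur because [Q] will be the conditional probability given Delta, while the law of
    [f] is the one under the original [P]. *)
Hypothesis indep : forall B, measurable B -> Q (A `&` f @^-1` B) = (Q A * P (f @^-1` B))%E.

Let mf : measurable_fun setT f.
Proof. exact/measurable_EFinP/(measurable_int _ intf). Qed.

Let fM : {mfun T >-> R} :=
  MeasurableFun.Pack (MeasurableFun.Class (isMeasurableFun.Build _ _ _ _ _ mf)).

Let g t := \1_A t * f t.

Let mg : measurable_fun setT g.
Proof. exact: measurable_funM. Qed.

Let gM : {mfun T >-> R} :=
  MeasurableFun.Pack (MeasurableFun.Class (isMeasurableFun.Build _ _ _ _ _ mg)).

Let qA : {nonneg R} := NngNum (fine_ge0 (measure_ge0 Q A)).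
Let qAC : {nonneg R} := NngNum (fine_ge0 (measure_ge0 Q (~` A))).

Let qAE : qA%:num%:E = Q A.
Proof. by rewrite fineK// fin_num_measure. Qed.

Let qACE : qAC%:num%:E = Q (~` A).
Proof. by rewrite fineK// fin_num_measure//; exact: measurableC. Qed.

(* Off A the function \1_A * f is 0, hence the Dirac mass in its law. *)
Let law_g B : measurable B ->
  distribution Q gM B =
  measure_add (mscale qA (distribution P fM)) (mscale qAC (@dirac _ R (0 : R) R)) B.
Proof.
move=> mB.
transitivity (Q A * P (f @^-1` B) + Q (~` A) * @dirac _ R (0 : R)%R R B)%E; last first.
  by rewrite measure_addE -qAE -qACE.
rewrite /distribution /pushforward /=.
have -> : g @^-1` B = (A `&` f @^-1` B) `|` (if 0 \in B then ~` A else set0).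
  apply/seteqP; split => t; rewrite /g /preimage /=.
    have [tA|tA] := pselect (A t).
      by rewrite indicE mem_set// mul1r; left.
    by rewrite indicE memNset// mul0r => B0; right; rewrite mem_set.
  case=> [[tA Bft]|]; first by rewrite indicE mem_set// mul1r.
  by case: ifPn => // /set_mem B0 tA; rewrite indicE memNset// mul0r.
have mC : measurable (if 0 \in B then ~` A else set0).
  by case: ifP => _; [exact: measurableC|exact: measurable0].
rewrite measureU//; last 2 first.
- by apply: measurableI => //; rewrite -[X in measurable X]setTI; exact: mf.
- by case: ifP => _; apply/seteqP; split=> // t [[]].
congr (_ + _)%E; first exact: indep.
rewrite diracE; case: ifP => _; first by rewrite mule1.
by rewrite measure0 mule0.
Qed.

(** Change of variables to the law of [g]; the condition h 0 = 0 removes the Dirac part. *)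
Let ge0_integral_g (h : R -> \bar R) : measurable_fun setT h ->
    (forall y, 0 <= h y)%E -> h 0 = 0%E ->
  (\int[Q]_t h (g t) = Q A * \int[P]_t h (f t))%E.
Proof.
move=> mh h0 h00.
transitivity (\int[distribution Q gM]_y h y)%E.
  by rewrite ge0_integral_distribution.
rewrite (@eq_measure_integral _ _ _ setT
  (measure_add (mscale qA (distribution P fM)) (mscale qAC (@dirac _ R (0 : R) R)))); last first.
  by move=> B mB _; exact: law_g.
rewrite ge0_integral_measure_add//.
rewrite !ge0_integral_mscale// integral_dirac// h00 !mule0 adde0.
rewrite ge0_integral_distribution//=.
by rewrite qAE.
Qed.

Lemma integrable_indic_mul : Q.-integrable setT (fun t => (\1_A t * f t)%:E).
Proof.
apply/integrableP; split; first exact/measurable_EFinP.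
rewrite (ge0_integral_g (h := fun y => `|y%:E|%E)) ?abse0//; last first.
  by apply: measurableT_comp => //; exact/measurable_EFinP.
have /integrableP[_ oo] := intf.
by rewrite ltey_eq fin_numM// ?fin_num_measure// ge0_fin_numE// integral_ge0.
Qed.

(** The positive and negative parts of the identity both vanish at 0, so [ge0_integral_g] applies to
    each, and integrability of [f] lets the factor Q A distribute over the difference. *)
Lemma integral_indic_mul :
  (\int[Q]_t (\1_A t * f t)%:E = Q A * \int[P]_t (f t)%:E)%E.
Proof.
have mid : measurable_fun setT (EFin : R -> \bar R) by exact/measurable_EFinP.
rewrite integralE [in RHS]integralE.
have pos : (\int[Q]_t (EFin \o g)^\+ t = Q A * \int[P]_t (EFin \o f)^\+ t)%E.
  under eq_integral do rewrite funepos_comp.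
  under [in RHS]eq_integral do rewrite funepos_comp.
  apply: (ge0_integral_g (h := (EFin : R -> \bar R)^\+%E)) => //.
  - exact: measurable_funepos.
  - by rewrite funeposE maxxx.
have neg : (\int[Q]_t (EFin \o g)^\- t = Q A * \int[P]_t (EFin \o f)^\- t)%E.
  under eq_integral do rewrite funeneg_comp.
  under [in RHS]eq_integral do rewrite funeneg_comp.
  apply: (ge0_integral_g (h := (EFin : R -> \bar R)^\-%E)) => //.
  - exact: measurable_funeneg.
  - by rewrite funenegE oppe0 maxxx.
rewrite pos neg [RHS]muleBr// ?fin_num_measure//.
exact: integrable_add_def.
Qed.

End restricted_independence.

(** * Expectations as finite mixtures over the count vectors *)

Lemma bounded_countsP (n k : nat) (c : 'I_n -> nat) :
  (forall i, (c i <= k)%N) ->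
  exists s : {ffun 'I_n -> 'I_k.+1}, (fun i => s i : nat) = c.
Proof.
move=> ck; exists [ffun i => inord (c i)].
by apply/funext => i; rewrite ffunE inordK// ltnS.
Qed.

Section count_mixture.
Context {d : measure_display} {T : measurableType d} {R : realType} {n : nat}.
Context (eta : 'I_n -> T -> nat).
Hypothesis meta : forall i, measurable_fun setT (eta i).

Definition count_event (m : 'I_n -> nat) : set T := [set t | eta ^~ t = m].

Lemma measurable_count_event m : measurable (count_event m).
Proof.
have -> : count_event m = \big[setI/setT]_(i < n) (eta i @^-1` [set m i]).
  rewrite -bigcap_seq; apply/seteqP; split => t /=; first by move=> <-.
  by move=> mt; apply/funext => i; apply: mt; rewrite /= mem_index_enum.
apply: bigsetI_measurable => i _; rewrite -[X in measurable X]setTI.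
exact: meta.
Qed.

(** Count vectors are countably many, so every preimage is a countable union of events
    [count_event m]. *)
Lemma measurable_count_fun (H : ('I_n -> nat) -> R) :
  measurable_fun setT (fun t => H (eta ^~ t)).
Proof.
move=> _ B mB; rewrite setTI.
pose F (m : {ffun 'I_n -> nat}) :=
  if `[< B (H m) >] then count_event m else set0.
have -> : (fun t => H (eta ^~ t)) @^-1` B = \bigcup_m F m.
  apply/seteqP; split => [t Bt|t [m _]].
    exists [ffun i => eta i t] => //; rewrite /F.
    have -> : ([ffun i => eta i t] : 'I_n -> nat) = (eta ^~ t).
      by apply/funext => i; rewrite ffunE.
    by rewrite asboolT.
  by rewrite /F; case: asboolP => // BHm mt; rewrite /preimage /= mt.
apply: countable_bigcupT_measurable => [|m]; first exact: countableP.
by rewrite /F; case: ifP => // _; exact: measurable_count_event.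
Qed.

Context (k : nat) (Q : probability T R).
Hypothesis eta_le : {ae Q, forall t, forall i, (eta i t <= k)%N}.

Implicit Types s : {ffun 'I_n -> 'I_k.+1}.

(** The measure is an argument, so that the conditional and the unconditional laws of the counts can
    be compared. *)
Definition count_prob (Q : probability T R) s : R :=
  fine (Q (count_event (fun i => s i))).

Lemma count_prob_ge0 s : 0 <= count_prob Q s.
Proof. exact: fine_ge0. Qed.

Lemma count_probE s : Q (count_event (fun i => s i)) = (count_prob Q s)%:E.
Proof. by rewrite fineK// fin_num_measure//; exact: measurable_count_event. Qed.

(** Only finitely many count vectors matter, so those of probability zero can be discarded
    together. *)
Lemma count_ae (S : set ('I_n -> nat)) :
    (forall s, count_prob Q s != 0 -> S (fun i => s i)) ->
  {ae Q, forall t, S (eta ^~ t)}.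
Proof.
move=> HS; have : {ae Q, forall t, forall s, count_prob Q s = 0 ->
    ~ count_event (fun i => s i) t}.
  apply: filter_forall => s; have [qs|qs] := eqVneq (count_prob Q s) 0; last first.
    by apply: aeW => t /eqP; rewrite (negbTE qs).
  exists (count_event (fun i => s i)); split.
  - exact: measurable_count_event.
  - by rewrite count_probE qs.
  - by move=> t /= H; apply: contrapT => nt; apply: H.
apply: filterS2 eta_le => t /bounded_countsP[s0 s0E] nullt.
rewrite -s0E; apply: HS; apply/eqP => /nullt; apply.
by rewrite /count_event /= s0E.
Qed.

Section mixture.
Context (P : probability T R) (f : T -> R) (H : ('I_n -> nat) -> R).
Hypothesis intf : P.-integrable setT (EFin \o f).
Hypothesis indep : forall m B, measurable B ->
  Q (count_event m `&` f @^-1` B) = (Q (count_event m) * P (f @^-1` B))%E.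

Let term s t := ((H (fun i => s i))%:E *
  (\1_(count_event (fun i => s i)) t * f t)%:E)%E.

Let int_term s : Q.-integrable setT (term s).
Proof.
apply: integrableZl => //; apply: (integrable_indic_mul _ intf) => //.
- exact: measurable_count_event.
- by move=> B; exact: indep.
Qed.

Let mHf : measurable_fun setT (fun t => (H (eta ^~ t) * f t)%:E).
Proof.
apply/measurable_EFinP/measurable_funM; first exact: measurable_count_fun.
exact/measurable_EFinP/(measurable_int _ intf).
Qed.

Let term_ae : ae_eq Q setT (fun t => (H (eta ^~ t) * f t)%:E)
  (fun t => \sum_s term s t)%E.
Proof.
(* Almost every point has bounded counts, so exactly one term of the sum is active there. *)
apply: filterS eta_le => t /bounded_countsP[s0 s0E] _.
rewrite (bigD1 s0)//= [X in (_ + X)%E]big1 ?adde0 => [|s ss0].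
  by rewrite /term s0E indicE mem_set// mul1r EFinM.
rewrite /term indicE memNset ?mul0r ?mule0// => st.
move/eqP: ss0; apply; apply/ffunP => i; apply/val_inj.
exact: (congr1 (@^~ i) (etrans (esym st) (esym s0E))).
Qed.

Lemma integrable_count_mul :
  Q.-integrable setT (fun t => (H (eta ^~ t) * f t)%:E).
Proof.
have it : Q.-integrable setT (fun t => \sum_s term s t)%E.
  by apply: integrable_sum => // s _; exact: int_term.
have /integrableP[mt too] := it.
apply/integrableP; split=> //.
rewrite (ge0_ae_eq_integral (g := fun t => `|\sum_s term s t|%E))//.
- exact: measurableT_comp.
- exact: measurableT_comp.
- by apply: filterS term_ae => t tt Dt; rewrite -tt.
Qed.

(** On each count event H is constant, and independence factors the integral of [f] out of every
    term. *)
Lemma integral_count_mul :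
  (\int[Q]_t (H (eta ^~ t) * f t)%:E =
   ((\sum_s count_prob Q s * H (fun i => s i)) * fine (\int[P]_t (f t)%:E))%:E)%E.
Proof.
have it : Q.-integrable setT (fun t => \sum_s term s t)%E.
  by apply: integrable_sum => // s _; exact: int_term.
rewrite (ae_eq_integral (fun t => \sum_s term s t)%E)//; last exact: measurable_int it.
rewrite integral_sum//.
rewrite mulr_suml -sumEFin; apply: eq_bigr => s _.
have iI : Q.-integrable setT
    (fun t => (\1_(count_event (fun i => s i)) t * f t)%:E).
  apply: (integrable_indic_mul _ intf); first exact: measurable_count_event.
  by move=> B; exact: indep.
rewrite integralZl// (integral_indic_mul _ intf); last 2 first.
- exact: measurable_count_event.
- by move=> B; exact: indep.
rewrite count_probE !EFinM (fineK (integrable_fin_num measurableT intf)).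
by rewrite muleA (muleC (H _)%:E).
Qed.

End mixture.

(** The case of the constant factor 1, whose preimages are empty or everything and thus independent
    of any event. *)
Lemma integral_count (H : ('I_n -> nat) -> R) :
  Q.-integrable setT (fun t => (H (eta ^~ t))%:E) /\
  (\int[Q]_t (H (eta ^~ t))%:E =
   (\sum_s count_prob Q s * H (fun i => s i))%:E)%E.
Proof.
pose one : T -> R := cst 1.
have i1 : Q.-integrable setT (EFin \o one) by exact: finite_measure_integrable_cst.
have ind1 m B : measurable B -> Q (count_event m `&` one @^-1` B) =
    (Q (count_event m) * Q (one @^-1` B))%E.
  move=> _; rewrite preimage_cst; case: ifP => _.
    by rewrite setIT probability_setT mule1.
  by rewrite setI0 measure0 mule0.
have HE : (fun t => (H (eta ^~ t))%:E) = (fun t => (H (eta ^~ t) * one t)%:E).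
  by apply/funext => t; rewrite mulr1.
rewrite HE; split; first exact: integrable_count_mul i1 ind1.
rewrite (integral_count_mul _ i1 ind1).
by have := expectation_cst Q 1; rewrite unlock -/one => ->; rewrite /= mulr1.
Qed.

Lemma sum_count_prob : \sum_s count_prob Q s = 1.
Proof.
have [_] := integral_count (fun=> 1).
under [X in _ = X%:E -> _]eq_bigr do rewrite mulr1.
by have := expectation_cst Q 1; rewrite unlock => -> -[].
Qed.

End count_mixture.

(** * Generated sigma-algebras and conditioning on an event determined by the counts *)

Section generated_sigma_algebra.
Context {d d' : measure_display} {T : measurableType d} {T' : measurableType d'}.
Context {n : nat} (Y : 'I_n -> T -> T').

(** A copy of [T] carrying only the sigma-algebra generated by [Y]: being a function of [Y] becomes
    ordinary measurability on this type. *)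
Definition g_sigma_preimageType : Type :=
  g_sigma_algebraType
    (\big[setU/set0]_(i < n) preimage_set_system setT (Y i) measurable).
HB.instance Definition _ := Measurable.on g_sigma_preimageType.

Lemma g_sigma_preimageTypeE (A : set g_sigma_preimageType) :
  measurable A = g_sigma_preimage Y A.
Proof. by []. Qed.

Lemma measurable_component i :
  measurable_fun setT (Y i : g_sigma_preimageType -> T').
Proof.
move=> _ B mB; rewrite setTI.
suff : (\big[setU/set0]_(i < n) preimage_set_system setT (Y i) measurable)
    (Y i @^-1` B) by exact: sub_sigma_algebra.
by rewrite (bigD1 i)//=; left; exists B => //; rewrite setTI.
Qed.

End generated_sigma_algebra.

Section conditional_probability.
Context {d : measure_display} {T : measurableType d} {R : realType}.
Context (P : probability T R) (D : set T) (mD : measurable D).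
Hypothesis D_gt0 : 0 < fine (P D).

Lemma cond_probE B : (cond_prob P mD B = P (B `&` D) * ((fine (P D))^-1)%:E)%E.
Proof.
rewrite /cond_prob /= /mnormalize /= /mrestr setTI.
(* Positivity excludes the default branch of [mnormalize]. *)
have -> : (P D == 0)%E = false.
  by apply/eqP => PD; move: D_gt0; rewrite PD ltxx.
by have /fin_numP[_ /negbTE->] : P D \is a fin_num by exact: fin_num_measure.
Qed.

Lemma cond_prob_ae (S : T -> Prop) :
  {ae P, forall t, S t} -> {ae cond_prob P mD, forall t, S t}.
Proof.
move=> [N [mN PN SN]]; exists N; split => //.
rewrite cond_probE; have -> : P (N `&` D) = 0%E; last by rewrite mul0e.
by apply: (subset_measure0 _ mN _ PN) => //; exact: measurableI.
Qed.

End conditional_probability.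

Section conditional_independence.
Context {d d' : measure_display} {T : measurableType d} {T' : measurableType d'}.
Context {R : realType} {n : nat} (P : probability T R) (q : nat).
Context (Y : 'I_q -> T -> T') (eta : 'I_n -> T -> nat).
Context (S : set ('I_n -> nat)) (D := [set t | S (eta ^~ t)]) (mD : measurable D).
Hypothesis meta : forall i, measurable_fun setT (eta i).
Hypothesis indep : independent_families P Y eta.
Hypothesis D_gt0 : 0 < fine (P D).

Lemma count_eventI m :
  count_event eta m `&` D = if m \in S then count_event eta m else set0.
Proof.
case: ifPn => [/set_mem Sm|/negP mS]; apply/seteqP; split => t //=.
- by case.
- by move=> mt; split => //; rewrite /D /= mt.
- by case=> mt; rewrite /D /= mt => Sm; apply: mS; rewrite inE.
Qed.

(** Membership in [D] depends on the counts alone, so intersecting a count event with [D] leaves it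
    unchanged or empties it, and unconditional independence applies. *)
Lemma cond_prob_indep m (f : T -> R) B :
    measurable_fun setT (f : g_sigma_preimageType Y -> R) -> measurable B ->
  cond_prob P mD (count_event eta m `&` f @^-1` B) =
  (cond_prob P mD (count_event eta m) * P (f @^-1` B))%E.
Proof.
move=> mf mB; rewrite !cond_probE// setIAC count_eventI.
case: ifP => _; last by rewrite set0I measure0 !mul0e.
rewrite setIC indep; first by rewrite -muleA muleC.
- by rewrite -g_sigma_preimageTypeE -[X in measurable X]setTI; exact: mf.
- rewrite -g_sigma_preimageTypeE.
  by apply: (measurable_count_event (T := g_sigma_preimageType eta)) => i;
    exact: measurable_component.
Qed.

End conditional_independence.

(** * Integrability and moments of the errors *)

Section integrability.
Context {d : measure_display} {T : measurableType d} {R : realType}.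
Context (P : probability T R).

(** Extended subtraction with an infinite argument is never finite, so a finite integral forces both
    parts to be finite. This recovers integrability from the stated means and variances. *)
Lemma fin_num_integrable (f : T -> R) : measurable_fun setT f ->
  (\int[P]_t (f t)%:E)%E \is a fin_num -> P.-integrable setT (EFin \o f).
Proof.
move=> mf; rewrite integralE => fin.
have mEf : measurable_fun setT (EFin \o f) by exact/measurable_EFinP.
apply/integrableP; split => //.
rewrite (_ : (fun t => _) = (fun t => (EFin \o f)^\+ t + (EFin \o f)^\- t)%E); last first.
  by apply/funext => t; rewrite -[LHS]/((abse \o (EFin \o f)) t) fune_abse.
rewrite ge0_integralD//; [|exact: measurable_funepos|exact: measurable_funeneg].
have p0 : (0 <= \int[P]_t (EFin \o f)^\+ t)%E by exact: integral_ge0.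
have n0 : (0 <= \int[P]_t (EFin \o f)^\- t)%E by exact: integral_ge0.
move: (\int[P]_t _)%E (\int[P]_t (EFin \o f)^\- t)%E fin p0 n0.
by move=> [a| |] [b| |] //= _ _ _; rewrite -EFinD ltry.
Qed.

Lemma integrable_prod (f g : T -> R) :
    measurable_fun setT f -> measurable_fun setT g ->
    P.-integrable setT (fun t => (f t * f t)%:E) ->
    P.-integrable setT (fun t => (g t * g t)%:E) ->
  P.-integrable setT (fun t => (f t * g t)%:E).
Proof.
move=> mf mg f2 g2; have := integrableD measurableT f2 g2.
apply: le_integrable => //; first exact/measurable_EFinP/measurable_funM.
move=> t _; rewrite lee_fin /= [leRHS]ger0_norm; last first.
  by rewrite addr_ge0// -expr2 sqr_ge0.
(* The two squares bound the absolute product by the sum of the squares of f and g. *)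
have := sqr_ge0 (f t - g t); have := sqr_ge0 (f t + g t).
by rewrite ler_norml; move: (f t) (g t) => a b ? ?; apply/andP; split; nra.
Qed.

End integrability.

Section centered_errors.
Context {d : measure_display} {T : measurableType d} {R : realType}.
Context (P : probability T R) (n : nat) (eps : 'I_n -> {RV P >-> R}).
Context (sigma : R) (c : 'I_n -> R).
Hypothesis E_eps : forall i, ('E_P[eps i] = 0)%E.
Hypothesis V_eps : forall i, ('V_P[eps i] = (sigma ^+ 2)%:E)%E.
Hypothesis cov_y : forall i j, i != j ->
  (covariance P (fun t => (c i + eps i t)%R) (fun t => (c j + eps j t)%R) = 0)%E.

Lemma integrable_error i : P.-integrable setT (fun t => (eps i t)%:E).
Proof.
by apply: fin_num_integrable => //; have := E_eps i; rewrite unlock => ->.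
Qed.

Let second_moment i : (\int[P]_t (eps i t * eps i t)%:E = (sigma ^+ 2)%:E)%E.
Proof.
rewrite -(V_eps i) /variance covariance.unlock E_eps expectation.unlock.
by apply: eq_integral => t _ /=; rewrite fctE /= subr0.
Qed.

Lemma integrable_error_prod i j :
  P.-integrable setT (fun t => (eps i t * eps j t)%:E).
Proof.
have sq i' : P.-integrable setT (fun t => (eps i' t * eps i' t)%:E).
  by apply: fin_num_integrable; [exact: measurable_funM|rewrite second_moment].
exact: integrable_prod.
Qed.

Lemma expectation_shifted_error i : ('E_P[fun t => (c i + eps i t)%R] = (c i)%:E)%E.
Proof.
rewrite unlock; under eq_integral do rewrite EFinD.
rewrite integralD//; [|exact: finite_measure_integrable_cst|exact: integrable_error].
have := E_eps i; rewrite unlock => ->.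
by have := expectation_cst P (c i); rewrite unlock => ->; rewrite adde0.
Qed.

(** Centering cancels the shifts [c], so uncorrelated responses give uncorrelated errors. *)
Lemma error_moment i j :
  (\int[P]_t (eps i t * eps j t)%:E = (if i == j then sigma ^+ 2 else 0)%:E)%E.
Proof.
case: eqVneq => [->|ij]; first exact: second_moment.
rewrite -[RHS](cov_y ij) covariance.unlock !expectation_shifted_error expectation.unlock.
apply: eq_integral => t _ /=; rewrite fctE /=; congr (_ %:E); ring.
Qed.

End centered_errors.

(** * The mean of a binomial count *)

Section binomial_mean.
Context {R : realType}.

(** The absorption identity for j C(n, j) extracts n p and leaves the binomial expansion of ((1 - p)
    + p)^(n - 1). *)
Lemma binomial_mean n (p : R) :
  \sum_(j < n.+1) (p ^+ j * (1 - p) ^+ (n - j) *+ 'C(n, j)) * j%:R = n%:R * p.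
Proof.
case: n => [|n]; first by rewrite big_ord1 mulr0 mul0r.
rewrite big_ord_recl mulr0 add0r.
have -> : n.+1%:R * p = n.+1%:R * p * ((1 - p) + p) ^+ n :> R.
  by rewrite subrK expr1n mulr1.
rewrite exprDn mulr_sumr; apply: eq_bigr => j _.
rewrite /= /bump leq0n add1n subSS -mulr_natr -mulrA -natrM mulnC.
by rewrite -mul_bin_diag natrM /= -[X in _ = _ * X]mulr_natr exprS; ring.
Qed.

Lemma expectation_count {d : measure_display} {T : measurableType d}
    (P : probability T R) (eta : {RV P >-> nat}) n (p : R) :
    0 <= p <= 1 -> distribution P eta =1 binomial_prob n p ->
  (\int[P]_t ((eta t)%:R)%:E = (n%:R * p)%:E)%E.
Proof.
move=> /andP[p0 p1] etab.
have nat_ge0 (j : nat) : (0 <= (j%:R : R)%:E)%E by rewrite lee_fin.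
transitivity (\int[distribution P eta]_j (j%:R : R)%:E)%E.
  exact/esym/(ge0_integral_distribution _ _ nat_ge0).
rewrite (eq_measure_integral (binomial_prob n p)); last by move=> A _ _; exact: etab.
rewrite (integral_binomial n p1 nat_ge0).
by rewrite -binomial_mean -sumEFin; apply: eq_bigr => j _; rewrite -EFinM.
Qed.

End binomial_mean.

(** * The estimator given Delta: mean, covariance and Loewner bound *)

Lemma response_mean {d : measure_display} {T : measurableType d} {R : realType}
    (P : probability T R) n p (Z : 'M[R]_(n, p)) beta0 (beta1 : 'cV[R]_p)
    (eps : 'I_n -> {RV P >-> R}) i t :
  response Z beta0 beta1 eps i t =
  ((regressor Z i)^T *m col_mx beta0%:M beta1) 0 0 + eps i t.
Proof.
rewrite /response /regressor tr_col_mx trmxK trmx1 mul_row_col mul1mx.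
by rewrite [in RHS]mxE [X in _ = X + _ + _]mxE mulr1n.
Qed.

Theorem theorem1 (R : realType) (d : measure_display) (T : measurableType d)
    (P : probability T R) (n p k : nat) (Z : 'M[R]_(n, p))
    (beta0 : R) (beta1 : 'cV[R]_p) (sigma : R) (eps : 'I_n -> {RV P >-> R})
    (pi_ w : 'I_n -> R) (eta : 'I_n -> {RV P >-> nat})
    (y := response Z beta0 beta1 eps)
    (PDelta := fine (P (Delta_event Z eta)))
    (Pcond := cond_prob P (measurable_Delta_event Z eta))
    (beta_hat := fun t : T =>
       subsample_estimator Z w (fun i => y i t) (fun i => eta i t))
    (M_EL := expected_information Z sigma eta) :
  0 < sigma ->
  (forall i, ('E_P[eps i] = 0)%E) ->
  (forall i, 'V_P[eps i] = (sigma ^+ 2)%:E) ->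
  (forall i j, i != j -> covariance P (y i) (y j) = 0%E) ->
  random_subsample k pi_ eta ->
  independent_families P y (fun i => eta i : T -> nat) ->
  (forall i, 0 < pi_ i -> 0 < w i) ->
  0 < PDelta ->
  (forall a, 'E_Pcond[fun t => beta_hat t a 0%R]%E = (col_mx beta0%:M beta1 a 0)%:E)
  /\ (forall a b, covariance Pcond (fun t => beta_hat t a 0)
                    (fun t => beta_hat t b 0) \is a fin_num)
  /\ M_EL = (k%:R / sigma ^+ 2) *: gram Z pi_
  /\ M_EL \in unitmx
  /\ loewner_ge (cov_mx Pcond beta_hat) (PDelta *: invmx M_EL)
  /\ PDelta *: invmx M_EL =
       (sigma ^+ 2 * PDelta / k%:R) *: invmx (gram Z pi_).
Proof.
move=> sigma_gt0 E_eps V_eps cov_y [pi_ge0 pi_sum sum_eta mode] indep w_gt0 PD_gt0.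
pose x := regressor Z.
pose b : 'cV[R]_(1 + p) := col_mx beta0%:M beta1.
pose mu i := ((x i)^T *m b) 0 0.
have yE i : y i = fun t => mu i + eps i t.
  by apply/funext => t; rewrite /y response_mean.
have {}cov_y i j : i != j ->
    covariance P (fun t => mu i + eps i t) (fun t => mu j + eps j t) = 0%E.
  by move=> ij; rewrite -!yE cov_y.
have meta i : measurable_fun setT (eta i) by exact: measurable_funPT.
(* The counts sum to k almost surely, so each is at most k and the finite type [S] below captures
   them. *)
have leP : {ae P, forall t, forall i, (eta i t <= k)%N}.
  by apply: filterS sum_eta => t <- i; rewrite (bigD1 i)//= leq_addr.
have leQ : {ae Pcond, forall t, forall i, (eta i t <= k)%N} by exact: cond_prob_ae.
pose S := {ffun 'I_n -> 'I_k.+1}; pose m (s : S) i : nat := s i.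
pose q (s : S) := count_prob (eta : 'I_n -> T -> nat) Pcond s.
pose r (s : S) := count_prob (eta : 'I_n -> T -> nat) P s.
have pi_le1 i : pi_ i <= 1.
  by rewrite -pi_sum (bigD1 i)//= lerDl sumr_ge0.
(* The two sampling schemes enter only here: Binomial(k, pi_i) and Binomial(1, k pi_i) have the same
   mean. *)
have r_mean i : \sum_s r s * (m s i)%:R = k%:R * pi_ i.
  have [_] := integral_count meta leP (fun c => (c i)%:R).
  have -> : (\int[P]_t ((eta i t)%:R)%:E = (k%:R * pi_ i)%:E)%E.
    case: mode => [wr|[le1 wor]].
      by apply: expectation_count => //; rewrite pi_ge0 pi_le1.
    rewrite (expectation_count _ (wor i)) ?mul1r//.
    by rewrite le1 mulr_ge0.
  by case.
have q_ge0 s : 0 <= q s by exact: count_prob_ge0.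
have r_ge0 s : 0 <= r s by exact: count_prob_ge0.
have q_sum : \sum_s q s = 1 by exact: sum_count_prob.
have q_le s : q s <= r s / PDelta.
  have mA := measurable_count_event meta (m s).
  have mAD := measurableI _ _ mA (measurable_Delta_event Z eta).
  rewrite /q /r /count_prob cond_probE// fineM ?fin_num_measure//.
  rewrite ler_wpM2r ?invr_ge0 ?(ltW PD_gt0)// fine_le ?fin_num_measure//.
  by apply: le_measure; rewrite ?inE.
have q_Delta s : q s != 0 -> Delta Z (m s).
  apply: contra_neqP => nD; rewrite /q /count_prob cond_probE//.
  by rewrite count_eventI memNset// measure0 mul0e.
(* If pi_i = 0 then eta_i has mean zero, so count vectors that include point i have probability
   zero. Hence weights are positive wherever sampling occurs. *)
have q_pi s i : q s != 0 -> (0 < m s i)%N -> 0 < pi_ i.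
  move=> qs ms; rewrite lt_neqAle pi_ge0 andbT eq_sym; apply: contraNneq qs => pi0.
  have /eqP := r_mean i; rewrite pi0 mulr0 psumr_eq0 => [/allP/(_ s)|s' _]; last first.
    by rewrite mulr_ge0.
  rewrite mem_index_enum implyTb mulf_eq0 pnatr_eq0 (gtn_eqF ms) orbF => /(_ isT)/eqP rs.
  by rewrite eq_le q_ge0 andbT (le_trans (q_le s))// rs mul0r.
have q_weight s i : q s != 0 -> (0 < m s i)%N -> 0 < w i.
  by move=> qs ms; exact/w_gt0/(q_pi s).
(* A count vector in Delta of positive probability; it yields both k > 0 and the invertibility of
   the Gram matrix of [pi_]. *)
have [s0 qs0] : exists s, q s != 0.
  apply: contrapT => /forallNP q0; have := q_sum.
  by rewrite big1 => [/esym/eqP|s _]; [rewrite oner_eq0|have /negP/negPn/eqP := q0 s].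
have k_gt0 : (0 < k)%N.
  rewrite lt0n; apply/eqP => k0; have := q_Delta s0 qs0.
  (* With k = 0 this Gram matrix would be zero, which is singular because its size 1 + p is
     positive. *)
  rewrite /Delta /=; have -> : gram Z (fun i => (m s0 i)%:R) = 0.
    rewrite /gram big1// => i _; have -> : m s0 i = 0%N; last by rewrite scale0r.
    by apply/eqP; rewrite -leqn0 -[X in (_ <= X)%N]k0 -ltnS ltn_ord.
  move=> /mulVmx/matrixP/(_ 0 0)/eqP; rewrite mulmx0 !mxE /= eq_sym.
  by rewrite oner_eq0.
have k_gt0R : 0 < k%:R :> R by rewrite ltr0n.
have pi_unit : gram Z pi_ \in unitmx.
  apply: gram_support_unit pi_ge0 _ (q_Delta s0 qs0) => i.
  by rewrite pnatr_eq0 -lt0n => /(q_pi s0 i qs0)/lt0r_neq0.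
have s2_neq0 : k%:R / sigma ^+ 2 != 0 by rewrite mulf_neq0 ?invr_eq0 ?expf_neq0 ?gt_eqF.
have M_ELE : M_EL = (k%:R / sigma ^+ 2) *: gram Z pi_.
  apply/matrixP => i j; rewrite mxE expectation.unlock.
  have [_] := integral_count meta leP
    (fun c => ((sigma ^+ 2)^-1 *: gram Z (fun i => (c i)%:R)) i j).
  move=> ->; rewrite /=.
  have -> : (k%:R / sigma ^+ 2) *: gram Z pi_ =
      \sum_s r s *: ((sigma ^+ 2)^-1 *: gram Z (fun i => (m s i)%:R)).
    have gr : gram Z (fun i => \sum_s r s * (m s i)%:R) = k%:R *: gram Z pi_.
      by rewrite -gramZ; congr gram; apply/funext => l; exact: r_mean.
    rewrite mulrC -scalerA -gr gram_sum scaler_sumr; apply: eq_bigr => s _.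
    by rewrite !scalerA mulrC.
  by rewrite summxE; apply: eq_bigr => s _; rewrite [RHS]mxE.
have M_EL_unit : M_EL \in unitmx by rewrite M_ELE unitmxZ ?unitfE.
have invE : PDelta *: invmx M_EL = (sigma ^+ 2 * PDelta / k%:R) *: invmx (gram Z pi_).
  rewrite M_ELE invmxZ; last by rewrite -M_ELE.
  by rewrite scalerA invf_div; congr (_ *: _); ring.
(* Given Delta, functions of the counts and functions of the responses still factor. *)
have mixQ (f : T -> R) (H : ('I_n -> nat) -> R) :
    measurable_fun setT (f : g_sigma_preimageType y -> R) ->
    P.-integrable setT (EFin \o f) ->
  Pcond.-integrable setT (fun t => (H (fun i => eta i t) * f t)%:E) /\
  (\int[Pcond]_t (H (fun i => eta i t) * f t)%:E =
   ((\sum_s q s * H (m s)) * fine (\int[P]_t (f t)%:E))%:E)%E.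
  move=> mf intf; have ind c B : measurable B ->
      Pcond (count_event eta c `&` f @^-1` B) =
      (Pcond (count_event eta c) * P (f @^-1` B))%E.
    by move=> mB; apply: cond_prob_indep mf mB.
  split; first exact: (integrable_count_mul meta leQ H intf ind).
  by rewrite (integral_count_mul meta leQ H intf ind).
have my i : measurable_fun setT (y i : g_sigma_preimageType y -> R).
  exact: measurable_component.
(* Errors are responses minus constants, so they inherit independence from the counts. *)
have meps i : measurable_fun setT (eps i : g_sigma_preimageType y -> R).
  have -> : (eps i : T -> R) = fun t => y i t - mu i.
    by apply/funext => t; rewrite yE addrC addKr.
  exact: (measurable_funB (T := g_sigma_preimageType y)).
have int_eps i j := integrable_error_prod E_eps V_eps i j.
have int_y i : P.-integrable setT (EFin \o y i).
  rewrite yE; have := integrableD measurableT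
    (finite_measure_integrable_cst P (mu i) measurableT) (integrable_error E_eps i).
  by apply: eq_integrable => // t _; rewrite /= EFinD.
pose K i a c : R := estimator_mx Z w c a i.
have bhE a : (fun t => beta_hat t a 0) =
    fun t => \sum_i K i a (fun j => eta j t) * y i t.
  by apply/funext => t; exact: subsample_estimatorE.
have K_fit s a : q s != 0 -> \sum_i K i a (m s) * mu i = b a 0.
  by move=> qs; apply: estimator_mx_fit (q_Delta s qs) _ _ => i; exact: q_weight.
have E_bh a : ('E_Pcond[fun t => beta_hat t a 0%R] = (b a 0)%:E)%E.
  rewrite bhE expectation.unlock; under eq_integral do rewrite -sumEFin.
  rewrite integral_sum//; last by move=> i; have [] := mixQ _ (K i a) (my i) (int_y i).
  under eq_bigr do rewrite (mixQ _ (K _ a) (my _) (int_y _)).2.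
  have Ey i : (\int[P]_t (y i t)%:E = (mu i)%:E)%E.
    by have := expectation_shifted_error mu E_eps i; rewrite expectation.unlock yE.
  under eq_bigr do rewrite Ey /= mulr_suml.
  rewrite sumEFin exchange_big /=; congr (_ %:E).
  rewrite -[RHS]mul1r -q_sum mulr_suml; apply: eq_bigr => s _.
  have [->|qs] := eqVneq (q s) 0.
    by rewrite mul0r big1// => i _; rewrite !mul0r.
  by rewrite -(K_fit s a qs) mulr_sumr; apply: eq_bigr => i _; rewrite mulrA.
pose F (a1 a2 : 'I_(1 + p)) i j c := K i a1 c * K j a2 c.
(* The exact fit removes the mean, so the estimation error is linear in the errors. *)
have residual a : {ae Pcond, forall t,
    beta_hat t a 0 - b a 0 = \sum_i K i a (fun j => eta j t) * eps i t}.
  have fit_ae : {ae Pcond, forall t, \sum_i K i a (fun j => eta j t) * mu i = b a 0}.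
    apply: (count_ae meta leQ (S := [set c | \sum_i K i a c * mu i = b a 0])) => s.
    exact: K_fit.
  apply: filterS fit_ae => t Ht.
  rewrite (congr1 (@^~ t) (bhE a)) -Ht -sumrB; apply: eq_bigr => i _.
  by rewrite -mulrBr yE addrAC subrr add0r.
have int_F a1 a2 i j : Pcond.-integrable setT
    (fun t => (F a1 a2 i j (fun l => eta l t) * (eps i t * eps j t))%:E).
  by have [] := mixQ _ (F a1 a2 i j) (measurable_funM (meps i) (meps j)) (int_eps i j).
have covE a1 a2 : (covariance Pcond (fun t => beta_hat t a1 0%R) (fun t => beta_hat t a2 0%R)
    = (sigma ^+ 2 * \sum_s q s * \sum_i K i a1 (m s) * K i a2 (m s))%:E)%E.
  have mbh a : measurable_fun setT (fun t => beta_hat t a 0 - b a 0).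
    apply: measurable_funB => //; rewrite bhE; apply: measurable_sum => i.
    apply: measurable_funM; first exact: (measurable_count_fun meta (K i a)).
    by apply/measurable_EFinP; exact: measurable_int (int_y i).
  have int_sF : Pcond.-integrable setT (fun t => \sum_i \sum_j
      (F a1 a2 i j (fun l => eta l t) * (eps i t * eps j t))%:E)%E.
    by apply: integrable_sum => // i _; apply: integrable_sum.
  rewrite covariance.unlock !E_bh expectation.unlock.
  transitivity (\int[Pcond]_t
      ((beta_hat t a1 0 - b a1 0) * (beta_hat t a2 0 - b a2 0))%:E)%E => //.
  rewrite (ae_eq_integral (fun t => \sum_i \sum_j
      (F a1 a2 i j (fun l => eta l t) * (eps i t * eps j t))%:E)%E)//; last 3 first.
  - exact/measurable_EFinP/measurable_funM.
  - exact: measurable_int int_sF.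
  - apply: filterS2 (residual a1) (residual a2) => t -> -> _.
    under [RHS]eq_bigr do rewrite sumEFin; rewrite sumEFin; congr (_ %:E).
    rewrite mulr_suml; apply: eq_bigr => i _; rewrite mulr_sumr.
    by apply: eq_bigr => j _; rewrite mulrACA.
  rewrite integral_sum//; last by move=> i; apply: integrable_sum.
  under eq_bigr do rewrite integral_sum//.
  (* Off-diagonal terms vanish because distinct errors are uncorrelated. *)
  transitivity (\sum_i ((\sum_s q s * F a1 a2 i i (m s)) * sigma ^+ 2)%:E)%E.
    apply: eq_bigr => i _; rewrite (bigD1 i)//= [X in (_ + X)%E]big1 ?adde0 => [|j ji].
      rewrite (mixQ _ (F a1 a2 i i) (measurable_funM (meps i) (meps i)) (int_eps i i)).2.
      by rewrite (error_moment E_eps V_eps cov_y) eqxx.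
    rewrite (mixQ _ (F a1 a2 i j) (measurable_funM (meps i) (meps j)) (int_eps i j)).2.
    by rewrite (error_moment E_eps V_eps cov_y) eq_sym (negbTE ji) mulr0.
  rewrite sumEFin -mulr_suml mulrC; congr ((_ * _) %:E).
  rewrite exchange_big /=; apply: eq_bigr => s _.
  by rewrite mulr_sumr.
pose E s := estimator_mx Z w (m s).
have cov_mxE : cov_mx Pcond beta_hat =
    sigma ^+ 2 *: \sum_s q s *: (E s *m (E s)^T).
  apply/matrixP => a1 a2; rewrite !mxE covE /= summxE; congr (_ * _).
  apply: eq_bigr => s _; rewrite !mxE; congr (_ * _).
  by apply: eq_bigr => i _; rewrite [X in _ = _ * X]mxE.
split; first exact: E_bh.
split; first by move=> a1 a2; rewrite covE.
do 2 (split; first by []); split; last by [].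
split.
  have trM : M_EL^T = M_EL by rewrite M_ELE linearZ /= tr_gram.
  rewrite linearB /= linearZ /= trmx_inv trM; congr (_ - _).
  apply/matrixP => a1 a2; rewrite !mxE !covE; congr (_ * _).
  by apply: eq_bigr => s _; congr (_ * _); apply: eq_bigr => i _; rewrite mulrC.
move=> u; rewrite mulmxBr mulmxBl [leRHS]mxE [X in _ + X]mxE subr_ge0 invE cov_mxE.
rewrite -!scalemxAr -!scalemxAl [X in X <= _]mxE [X in _ <= X]mxE.
rewrite -(mulrA _ PDelta) -(mulrA (sigma ^+ 2)).
rewrite ler_wpM2l ?sqr_ge0//.
apply: le_trans (mixture_estimator_bound (q := q) (r := r) (m := m) (w := w) _ k_gt0R
  q_ge0 q_sum q_le q_Delta q_weight r_mean pi_unit u) _ => //.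
(* The two sides agree: the form of C C^T at u is the squared norm of u^T C. *)
rewrite mulmx_sumr mulmx_suml summxE le_eqVlt; apply/orP; left; apply/eqP.
apply: eq_bigr => s _; rewrite -scalemxAr -scalemxAl mxE; congr (_ * _).
rewrite mulmxA -(mulmxA _ _ u) -[(E s)^T *m u]trmxK trmx_mul trmxK mxE.
by apply: eq_bigr => i _; rewrite [X in _ = _ * X]mxE expr2.
Qed.
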